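(* For integers $p',q',r'$ let $\min(p',q',r';|E|)$ denote the minimum of $|E(G)|$ over all connected finite simple graphs $G$ with $\mathrm{ind\text{-}match}(G)=p'$, $\mathrm{min\text{-}match}(G)=q'$ and $\mathrm{match}(G)=r'$. Let $p,q,r$ be integers with $1\le p\le q\le r\le 2q$. Then: (1) $\min(1,q,2q;|E|)=\binom{2q+1}{2}$ and $\min(1,q,2q-1;|E|)=\binom{2q}{2}$ for all $q\ge 1$; (2) $\min(q,q,r;|E|)=2r-1$ if $2\le p=q<r\le 2q$; (3) $\min(r,r,r;|E|)=2r$ if $2\le p=q=r$.
   Context: All graphs are finite and simple. A matching of $G$ is a set of pairwise disjoint edges. A maximal matching is a matching not properly contained in another matching. An induced matching is a matching $M$ such that for distinct $e,f\in M$ there is no edge $g$ of $G$ meeting both $e$ and $f$. $\mathrm{match}(G)$ is the maximum size of a matching, $\mathrm{min\text{-}match}(G)$ the minimum size of a maximal matching, and $\mathrm{ind\text{-}match}(G)$ the maximum size of an induced matching of $G$. For every $1\le p\le q\le r\le 2q$ there exists a connected graph with these three invariants equal to $p,q,r$. *)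

(* Defs.v *)
From mathcomp Require Import all_boot.

Set Implicit Arguments.
Unset Strict Implicit.
Unset Printing Implicit Defensive.

Record sgraph := SGraph {
  vertex :> finType;
  adj : rel vertex;
  adj_sym : symmetric adj;
  adj_irrefl : irreflexive adj }.

Definition edges (G : sgraph) : {set {set G}} :=
  [set e : {set G} | [exists x, exists y, adj x y && (e == [set x; y])]].

Definition connected_graph (G : sgraph) : Prop :=
  0 < #|G| /\ forall x y : G, connect (@adj G) x y.

Definition matching (G : sgraph) (M : {set {set G}}) : bool :=
  (M \subset edges G) && trivIset M.

Definition maximal_matching (G : sgraph) (M : {set {set G}}) : bool :=
  maxset (@matching G) M.

Definition induced_matching (G : sgraph) (M : {set {set G}}) : bool :=
  matching M &&
  [forall e in M, forall f in M, (e != f) ==>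
     ~~ [exists g in edges G, ~~ [disjoint g & e] && ~~ [disjoint g & f]]].

Definition match_num (G : sgraph) : nat :=
  \max_(M : {set {set G}} | matching M) #|M|.

Definition ind_match (G : sgraph) : nat :=
  \max_(M : {set {set G}} | induced_matching M) #|M|.

Lemma ex_maximal_matching (G : sgraph) :
  exists n, [exists M : {set {set G}}, maximal_matching M && (#|M| == n)].
Proof.
have m0 : matching (set0 : {set {set G}}).
  by rewrite /matching sub0set; apply/trivIsetP => A B; rewrite inE.
have [M maxM _] := maxset_exists m0.
by exists #|M|; apply/existsP; exists M; rewrite /maximal_matching maxM eqxx.
Qed.

Definition min_match (G : sgraph) : nat := ex_minn (ex_maximal_matching G).

Definition realizes (p q r : nat) (G : sgraph) : Prop :=
  [/\ connected_graph G, ind_match G = p, min_match G = q & match_num G = r].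

(* min(p, q, r; |E|) = m, including that the minimum is attained. *)
Definition min_edges_eq (p q r m : nat) : Prop :=
  (exists2 G : sgraph, realizes p q r G & #|edges G| = m) /\
  (forall G : sgraph, realizes p q r G -> m <= #|edges G|).

(* Main.v *)
(** If no two edges of a maximum matching M (of size r) form an induced matching,
then any two edges of M are both met by some edge of G. Since an edge meets at
most two edges of M, this gives 'C(r, 1) + 'C(r, 2) edges. A connected graph has
at least #|G| - 1 edges, and #|G| >= 2 r; if M is moreover induced and r >= 2,
then #|G| > 2 r, since otherwise M would be the whole edge set.

These bounds are attained by a clique with a pendant edge at each vertex for
(1), by a spider with r legs of length two for (3), and for (2) by the tree
obtained from r - q paths P4 and 2 q - r single edges by joining them all to an
inner vertex of the first path. *)
Require Import Defs.
From mathcomp Require Import all_boot zify.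

Set Implicit Arguments.
Unset Strict Implicit.
Unset Printing Implicit Defensive.

(** * Edges, matchings and the three invariants of a general graph *)

Lemma meetP (T : finType) (A B : {set T}) :
  reflect (exists2 x, x \in A & x \in B) (~~ [disjoint A & B]).
Proof.
rewrite -setI_eq0; apply: (iffP (set0Pn _)) => [[x /setIP[]]|[x xA xB]]; exists x => //.
by rewrite inE xA.
Qed.

Section Graph.
Variable G : sgraph.
Implicit Types (M N : {set {set G}}) (e f g : {set G}) (x y : G).

Lemma edgesP e :
  reflect (exists x y, adj x y /\ e = [set x; y]) (e \in edges G).
Proof.
rewrite inE; apply: (iffP existsP) => [[x /existsP[y /andP[xy /eqP]]]|].
  by exists x, y.
by case=> x [y [xy ->]]; exists x; apply/existsP; exists y; rewrite xy eqxx.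
Qed.

Lemma edge_set2 x y : adj x y -> [set x; y] \in edges G.
Proof. by move=> xy; apply/edgesP; exists x, y. Qed.

Lemma adj_neq x y : adj x y -> x != y.
Proof. by apply: contraTneq => ->; rewrite adj_irrefl. Qed.

Lemma card_edge e : e \in edges G -> #|e| = 2.
Proof. by case/edgesP=> x [y [/adj_neq xy ->]]; rewrite cards2 xy. Qed.

Lemma matching_meet M e f :
  matching M -> e \in M -> f \in M -> ~~ [disjoint e & f] -> e = f.
Proof.
case/andP=> _ /trivIsetP tM eM fM; apply: contraNeq; exact: tM.
Qed.

Lemma card_cover_matching M : matching M -> #|cover M| = 2 * #|M|.
Proof.
case/andP=> /subsetP sM /eqP <-.
rewrite mulnC -sum_nat_const; apply: eq_bigr => e /sM; exact: card_edge.
Qed.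

Lemma matching_set0 : @matching G set0.
Proof. by rewrite /matching sub0set; apply/trivIsetP => A B; rewrite inE. Qed.

Lemma match_num_witness : exists2 M : {set {set G}}, matching M & #|M| = match_num G.
Proof.
have m0 : 0 < #|@matching G| by apply/card_gt0P; exists set0; apply: matching_set0.
by have [M ? ?] := eq_bigmax_cond (fun M => #|M|) m0; exists M.
Qed.

Lemma ind_match_witness : exists2 N : {set {set G}}, induced_matching N & #|N| = ind_match G.
Proof.
have i0 : 0 < #|@induced_matching G|.
  apply/card_gt0P; exists set0; apply/andP; split; first exact: matching_set0.
  by apply/forall_inP => e; rewrite inE.
by have [N ? ?] := eq_bigmax_cond (fun N => #|N|) i0; exists N.
Qed.

Lemma min_match_witness : exists2 M : {set {set G}}, maximal_matching M & #|M| = min_match G.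
Proof.
by rewrite /min_match; case: ex_minnP => n /existsP[M /andP[? /eqP ?]] _; exists M.
Qed.

Lemma leq_match_num M : matching M -> #|M| <= match_num G.
Proof. exact: leq_bigmax_cond. Qed.

Lemma leq_ind_match N : induced_matching N -> #|N| <= ind_match G.
Proof. exact: leq_bigmax_cond. Qed.

Lemma min_match_leq M : maximal_matching M -> min_match G <= #|M|.
Proof.
rewrite /min_match; case: ex_minnP => n _ min_n maxM.
by apply: min_n; apply/existsP; exists M; rewrite maxM eqxx.
Qed.

Lemma match_num_card : 2 * match_num G <= #|G|.
Proof.
by have [M mM <-] := match_num_witness; rewrite -(card_cover_matching mM) max_card.
Qed.

Lemma induced_meet N e f g :
  induced_matching N -> e \in N -> f \in N -> g \in edges G ->
  ~~ [disjoint g & e] -> ~~ [disjoint g & f] -> e = f.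
Proof.
case/andP=> _ /forall_inP indN eN fN gE ge gf; apply/eqP; apply: contraT => ef.
have /forall_inP/(_ f fN)/implyP/(_ ef)/exists_inP[] := indN e eN.
by exists g; rewrite // ge.
Qed.

(** An edge disjoint from all of [M] could be added to [M]; maximality would put it in [M], making
    it disjoint from itself, hence empty. *)
Lemma maximal_meet M e :
  maximal_matching M -> e \in edges G -> exists2 f, f \in M & ~~ [disjoint f & e].
Proof.
case/maxsetP=> /andP[sM tM] maxM eE; apply/exists_inP; apply: contraT.
rewrite negb_exists => /forallP disj.
have {}disj f : f \in M -> [disjoint f & e].
  by move=> fM; have := disj f; rewrite fM /= negbK.
have mM' : matching (e |: M).
  rewrite /matching subUset sub1set eE sM; apply/trivIsetP => f g.
  case/setU1P=> [->|fM] /setU1P[->|gM]; rewrite ?eqxx // => fg.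
  - by rewrite disjoint_sym disj.
  - exact: disj.
  - by move/trivIsetP: tM; apply.
have eM : e \in M by rewrite -(maxM _ mM') ?setU11 ?subsetUr.
have [x [y [_ De]]] := edgesP _ eE.
have := disj e eM; rewrite -setI_eq0 setIid => /eqP e0.
by have := set21 x y; rewrite -De e0 inE.
Qed.

(* Each edge of an induced matching is met by an edge of the maximal matching,
and no edge meets two edges of an induced matching. *)
Lemma ind_match_leq_min : ind_match G <= min_match G.
Proof.
have [N indN <-] := ind_match_witness; have [M maxM <-] := min_match_witness.
have /andP[/andP[sN _] _] := indN; have /maxsetp/andP[sM _] := maxM.
(* At most one edge of [N] meets a given edge [f], so [pick] can only return that one; the default
   [set0] is the value where there is none. *)
pose met f := odflt set0 [pick e in N | ~~ [disjoint f & e]].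
apply: leq_trans (leq_imset_card met M); apply/subset_leq_card/subsetP => e eN.
have [f fM fe] := maximal_meet maxM (subsetP sN e eN).
apply/imsetP; exists f => //; rewrite /met; case: pickP => [e' /andP[e'N fe']|].
  by apply: induced_meet indN eN e'N (subsetP sM f fM) fe fe'.
by move/(_ e); rewrite eN fe.
Qed.

(** * Lower bounds on the number of edges *)

Lemma connected_cut (S : {set G}) x y :
  connected_graph G -> x \in S -> y \notin S ->
  exists u w, [/\ u \in S, w \notin S & adj u w].
Proof.
case=> _ conn xS yS.
suff /exists_inP[u uS /exists_inP[w wS uw]] :
  [exists u in S, exists w in ~: S, adj u w].
  by exists u, w; split=> //; rewrite inE in wS.
apply: contraT => /exists_inP noedge.
(* With no edge leaving it, [S] is a union of connected components. *)
have clS : closed (@adj G) S.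
  apply: (intro_closed (sym_connect_sym (@adj_sym G))).
  move=> u w uw uS; apply: contraT => wS; case: noedge.
  by exists u => //; apply/exists_inP; exists w; rewrite ?inE.
by rewrite -(closed_connect clS (conn x y)) xS in yS.
Qed.

(** A set [S] grows from one vertex: each step adds the outer end [w] of an edge leaving [S], and
    that edge is a new one inside the enlarged set. *)
Lemma connected_edges : connected_graph G -> #|G| <= #|edges G|.+1.
Proof.
move=> conn; have [/card_gt0P[x0 _] _] := conn.
suff grow k : k < #|G| -> exists S : {set G},
    [/\ x0 \in S, #|S| = k.+1 & k <= #|[set e in edges G | e \subset S]|].
  have [|S [_ _ leS]] := grow #|G|.-1; first by rewrite prednK; case: conn.
  have := subset_leq_card (_ : [set e in edges G | e \subset S] \subset edges G).
  by rewrite (setIdE (edges G)) subsetIl -setIdE => /(_ isT); lia.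
elim: k => [|k IH] ltk; first by exists [set x0]; rewrite set11 cards1.
have [|S [x0S cS leS]] := IH; first lia.
have /set0Pn[y] : ~: S != set0 by rewrite -card_gt0 cardsCs setCK cS; lia.
rewrite inE => yS; have [u [w [uS wS uw]]] := connected_cut conn x0S yS.
exists (w |: S); split; first by rewrite !inE x0S orbT.
  by rewrite cardsU1 wS cS.
have newE : [set u; w] \notin [set e in edges G | e \subset S].
  by rewrite inE subUset !sub1set (negPf wS) !andbF.
apply: leq_ltn_trans leS _; rewrite -add1n.
have <- : #|[set u; w] |: [set e in edges G | e \subset S]|
   = 1 + #|[set e in edges G | e \subset S]| by rewrite cardsU1 newE.
apply/subset_leq_card/subsetP => e /setU1P[->|].
  by rewrite inE edge_set2 // subUset !sub1set !inE uS eqxx orbT.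
by rewrite !inE => /andP[-> /subset_trans]; apply; apply: subsetUr.
Qed.

Lemma match_num_edges : connected_graph G -> 2 * match_num G - 1 <= #|edges G|.
Proof. by move/connected_edges; have := match_num_card; lia. Qed.

(** By connectivity some edge [[set u; w]] leaves [e], one of the at least two edges of a maximum
    induced matching [N]. If [w] were covered by [N], this edge would meet two edges of [N]. So [N]
    misses a vertex, and [connected_edges] gives the bound. *)
Lemma ind_match_edges :
  connected_graph G -> 2 <= ind_match G -> 2 * ind_match G <= #|edges G|.
Proof.
move=> conn; have [N indN <-] := ind_match_witness => leN.
have /andP[mN _] := indN; have /andP[/subsetP sN _] := mN.
suff : 2 * #|N| < #|G| by have := connected_edges conn; lia.
have [e [f [eN fN ef]]] : exists e f, [/\ e \in N, f \in N & e != f].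
  by have /card_gt1P[e [f [? ? ?]]] := leN; exists e, f.
have [x [x' [_ De]]] := edgesP _ (sN e eN).
have [y [y' [_ Df]]] := edgesP _ (sN f fN).
have xe : x \in e by rewrite De set21.
have ye : y \notin e.
  apply: contra ef => ye; apply/eqP/(matching_meet mN eN fN)/meetP.
  by exists y; rewrite // Df set21.
have [u [w [ue we uw]]] := connected_cut conn xe ye.
rewrite -(card_cover_matching mN) ltn_neqAle max_card andbT.
apply/eqP => full.
have /bigcupP[h hN wh] : w \in cover N.
  have /eqP-> : cover N == setT by rewrite eqEcard subsetT cardsT full leqnn.
  by rewrite inE.
case/negP: we; rewrite (induced_meet indN eN hN (edge_set2 uw)) //; apply/meetP.
  by exists u; rewrite // set21.
by exists w; rewrite // set22.
Qed.

(* The traces [set e in M | e meets g] of the edges g exhaust the subsets of M of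
cardinality one or two. *)
Lemma clique_edges : ind_match G <= 1 -> 'C(match_num G + 1, 2) <= #|edges G|.
Proof.
move=> ind1; have [M mM <-] := match_num_witness.
have /andP[/subsetP sM tM] := mM.
pose trace g := [set e in M | ~~ [disjoint g & e]].
(* Each end of [g] lies in at most one edge of [M], found by [pblock]. *)
have card_trace g : g \in edges G -> #|trace g| <= 2.
  move=> gE; rewrite -(card_edge gE).
  apply: leq_trans (leq_imset_card (pblock M) g); apply/subset_leq_card/subsetP.
  move=> e; rewrite inE => /andP[eM /meetP[x xg xe]]; apply/imsetP; exists x => //.
  by rewrite (def_pblock tM eM xe).
have selfmeet e : e \in M -> ~~ [disjoint e & e].
  move/sM/edgesP=> [x [y [_ ->]]]; apply/meetP; exists x; exact: set21.
pose draws k := [set A : {set {set G}} | A \subset M & #|A| == k].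
(* Pascal's rule, with ['C(#|M|, 1)] singletons and ['C(#|M|, 2)] pairs. *)
have -> : 'C(#|M| + 1, 2) = #|draws 1 :|: draws 2|.
  rewrite cardsU (_ : _ :&: _ = set0) ?cards0 ?subn0 ?cards_draws.
    by rewrite addn1 binS addnC.
  by apply/setP=> A; rewrite !inE; case: eqP => [->|]; rewrite ?andbF.
apply: leq_trans (leq_imset_card trace _); apply/subset_leq_card/subsetP => A.
rewrite !inE => /orP[] /andP[/subsetP sA].
  case/cards1P=> e DA; have eM : e \in M by apply: sA; rewrite DA set11.
  apply/imsetP; exists e; rewrite ?sM // DA; apply/setP=> f; rewrite !inE.
  apply/eqP/andP => [->|[fM ef]]; first by rewrite eM selfmeet.
  exact/esym/(matching_meet mM).
case/cards2P=> e [f [ef DA]].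
have eM : e \in M by apply: sA; rewrite DA set21.
have fM : f \in M by apply: sA; rewrite DA set22.
have [/exists_inP[g gE /andP[ge gf]]|nog] :=
  boolP [exists g in edges G, ~~ [disjoint g & e] && ~~ [disjoint g & f]].
  apply/imsetP; exists g => //; apply/eqP; rewrite eqEcard DA cards2 ef.
  by rewrite card_trace // subUset !sub1set !inE eM fM ge gf.
(* If no edge meets both [e] and [f], they form an induced matching of size two, against [ind1]. *)
suff /leq_ind_match : induced_matching [set e; f].
  by rewrite cards2 ef; move: ind1; lia.
rewrite /induced_matching /matching subUset !sub1set !sM //=.
rewrite (trivIsetS _ tM) ?subUset ?sub1set ?eM ?fM //=.
apply/forall_inP => e1 De1; apply/forall_inP => f1 Df1; apply/implyP.
move: De1 Df1; rewrite !inE => /orP[]/eqP-> /orP[]/eqP->; rewrite ?eqxx //= => _.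
apply: contra nog => /exists_inP[g gE ?]; apply/exists_inP; exists g => //.
by rewrite andbC.
Qed.

(** * Bounds on the invariants from a matching listed by its pairs of ends *)

Section Pairs.
Variables (I : finType) (h : I * bool -> G).
Hypotheses (h_inj : injective h) (h_adj : forall i, adj (h (i, false)) (h (i, true))).

Definition pair_edge i := [set h (i, false); h (i, true)].
Definition pair_edges := [set pair_edge i | i : I].

Lemma pair_edgeP x i : reflect (exists b, x = h (i, b)) (x \in pair_edge i).
Proof.
rewrite !inE; apply: (iffP orP) => [[]/eqP->|[[] ->]]; [by exists false|by exists true|..].
  by right.
by left.
Qed.

Lemma pair_edge_meet i j : ~~ [disjoint pair_edge i & pair_edge j] -> i = j.
Proof. by case/meetP=> _ /pair_edgeP[b ->] /pair_edgeP[c /h_inj[]]. Qed.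

Lemma pair_edges_matching : matching pair_edges.
Proof.
apply/andP; split; first by apply/subsetP=> _ /imsetP[i _ ->]; apply: edge_set2.
apply/trivIsetP => _ _ /imsetP[i _ ->] /imsetP[j _ ->]; apply: contraNT.
by move/pair_edge_meet->.
Qed.

Lemma card_pair_edges : #|pair_edges| = #|I|.
Proof.
rewrite card_imset // => i j eij; apply: pair_edge_meet; rewrite -eij.
by apply/meetP; exists (h (i, true)); rewrite set22.
Qed.

Lemma pairs_match_num : #|I| <= match_num G.
Proof. by rewrite -card_pair_edges leq_match_num ?pair_edges_matching. Qed.

Lemma pairs_ind_match :
  (forall i j b c, adj (h (i, b)) (h (j, c)) -> i = j) -> #|I| <= ind_match G.
Proof.
move=> hind; rewrite -card_pair_edges leq_ind_match // /induced_matching.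
rewrite pair_edges_matching; apply/forall_inP => _ /imsetP[i _ ->].
apply/forall_inP => _ /imsetP[j _ ->]; apply/implyP; apply: contra.
case/exists_inP=> g /edgesP[x [y [xy ->]]] /andP[].
case/meetP=> u gu /pair_edgeP[b Du] /meetP[w gw /pair_edgeP[c Dw]].
suff -> : i = j by [].
(* Either [u] and [w] are the same end of [g], and [h_inj] applies, or [g] joins them, and [hind]
   applies. *)
move: gu gw; rewrite !inE {}Du {}Dw.
case/orP=> /eqP Du /orP[]/eqP Dw; try by move: Du; rewrite -Dw => /h_inj[].
  by apply: (hind i j b c); rewrite Du Dw.
by apply: (hind i j b c); rewrite Du Dw adj_sym; apply: xy.
Qed.

(** The hypothesis makes the image of [h] a vertex cover, so every edge meets the matching, which is
    therefore maximal. *)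
Lemma pairs_min_match :
  (forall x y, adj x y -> (exists u, x = h u) \/ (exists u, y = h u)) ->
  min_match G <= #|I|.
Proof.
move=> hmax; rewrite -card_pair_edges min_match_leq //.
apply/maxsetP; split=> [|N /andP[sN tN] sMN]; first exact: pair_edges_matching.
apply/eqP; rewrite eqEsubset sMN andbT; apply/subsetP => e eN.
have meet_in u : h u \in e -> e \in pair_edges.
  case: u => i b ue; have iM : pair_edge i \in pair_edges by apply: imset_f.
  suff -> : e = pair_edge i by [].
  apply: (@matching_meet N) => //; [exact/andP | exact: (subsetP sMN) |].
  by apply/meetP; exists (h (i, b)) => //; apply/pair_edgeP; exists b.
have /edgesP[x [y [xy De]]] := subsetP sN e eN.
by case: (hmax x y xy) => [] [u Du]; apply: (meet_in u); rewrite De -Du ?set21 ?set22.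
Qed.

End Pairs.

End Graph.

(** * Trees given by a parent map: the spider and the joined paths *)

Section ParentGraph.
Variables (T : finType) (par : T -> T) (root : T).

(** The inequality removes the loop at the root, which is its own parent. *)
Definition par_adj x y := (x != y) && ((par x == y) || (par y == x)).

Lemma par_adj_sym : symmetric par_adj.
Proof. by move=> x y; rewrite /par_adj eq_sym orbC. Qed.

Lemma par_adj_irrefl : irreflexive par_adj.
Proof. by move=> x; rewrite /par_adj eqxx. Qed.

Definition par_graph := SGraph par_adj_sym par_adj_irrefl.

Hypotheses (par_root : par root = root)
  (par_iter : forall x, exists k, iter k par x = root).

Lemma par_graph_connected : connected_graph par_graph.
Proof.
split; first by apply/card_gt0P; exists root.
have toroot x : connect par_adj x root.
  have [k] := par_iter x; elim: k x => [|k IH] x; first by move=> /= ->.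
  rewrite iterSr => /IH; apply: connect_trans.
  have [->|npx] := eqVneq (par x) x; first exact: connect0.
  by apply: connect1; rewrite /par_adj eq_sym npx eqxx.
move=> x y; apply: connect_trans (toroot x) _.
by rewrite (sym_connect_sym par_adj_sym) toroot.
Qed.

(** Every edge joins some vertex other than the root to its parent. *)
Lemma par_graph_edges : #|edges par_graph| <= #|T|.-1.
Proof.
rewrite -cardsT (cardsD1 root) inE /=.
apply: leq_trans (leq_imset_card (fun x => [set x; par x] : {set par_graph}) _).
apply/subset_leq_card/subsetP => e eE.
have [x [y [/andP[xy pxy] ->]]] := @edgesP par_graph _ eE.
have xpy z t : z != t -> par z == t -> z \in [set: T] :\ root.
  move=> zt /eqP pz; rewrite !inE andbT; apply: contra zt => /eqP zr.
  by rewrite -pz zr par_root.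
have [px|py] := orP pxy; apply/imsetP.
  by exists x; [exact: xpy px | rewrite (eqP px)].
by exists y; [apply: xpy py; rewrite eq_sym | rewrite (eqP py) setUC].
Qed.

End ParentGraph.

(** [None] is the centre, and leg [i] runs through [Some (i, false)] to [Some (i, true)]. The outer
    edges of the legs form a matching that is both induced and maximal, and [2 * r + 1] vertices
    leave no room for [r + 1] disjoint edges. *)
Lemma spider_realizes r : 1 <= r ->
  exists2 G : sgraph, realizes r r r G & #|edges G| <= 2 * r.
Proof.
move=> r_gt0.
pose T : finType := option ('I_r * bool).
pose par (x : T) : T := if x is Some (i, true) then Some (i, false) else None.
have par_iter x : exists k, iter k par x = None.
  by exists 2; case: x => [[i []]|].
pose G := par_graph par.
have cardG : #|G| = 2 * r + 1.
  by rewrite card_option card_prod card_ord card_bool addn1 mulnC.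
have h_inj : injective (Some : 'I_r * bool -> G) by move=> x y [].
have h_adj i : @adj G (Some (i, false)) (Some (i, true)).
  by apply/andP; split; [apply/eqP | rewrite eqxx orbT].
have le_r_ind : r <= ind_match G.
  rewrite -[leqLHS]card_ord (pairs_ind_match h_inj h_adj) // => i j b c.
  by case/andP=> _ /orP[] /eqP; case: b c => [] [] //= [].
have min_le_r : min_match G <= r.
  rewrite -[leqRHS]card_ord (pairs_min_match h_inj h_adj) //.
  by move=> [x|] [y|] //; [left; exists x|left; exists x|right; exists y].
have le_r_match : r <= match_num G.
  by rewrite -[leqLHS]card_ord (pairs_match_num h_inj h_adj).
have := ind_match_leq_min G; have := match_num_card G; rewrite cardG => *.
exists G; last first.
  by apply: leq_trans (@par_graph_edges _ par None erefl) _; rewrite (cardG : #|T| = _); lia.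
split; [exact: par_graph_connected par_iter|lia..].
Qed.

(** Three matchings fix the invariants: all edges from [(i, false)] to [(i, true)] form a perfect
    matching, those with [i < q] an induced one, and the middle edges of the paths with the single
    edges a maximal one of size [q]. *)
Lemma tree_realizes q r : q < r -> r <= 2 * q ->
  exists2 G : sgraph, realizes q q r G & #|edges G| <= 2 * r - 1.
Proof.
move=> ltqr ler2q; pose T : finType := ('I_r * bool)%type.
pose root : 'I_r := Ordinal ltqr.
(* The paths are (i, true), (i, false), (q + i, false), (q + i, true) for
i < r - q, the single edges are (i, false), (i, true) for r - q <= i < q. *)
pose up (i : 'I_r) : 'I_r := if i < q then insubd root (q + i) else root.
have upE (i : 'I_r) : i < q -> q + i < r -> up i = q + i :> nat.
  by move=> iq qir; rewrite /up iq val_insubd qir.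
have up_ge (i : 'I_r) : q <= up i.
  by rewrite /up; case: ifP => // _; rewrite val_insubd; case: ifP => //= _; lia.
pose par (x : T) : T := if x.2 then (x.1, false) else (up x.1, false).
have par_root : par (root, false) = (root, false) by rewrite /par /= /up ltnn.
have par_iter x : exists k, iter k par x = (root, false).
  have upup i : up (up i) = root by rewrite {1}/up ltnNge up_ge.
  case: x => i [].
    by exists 3; rewrite /= /par_adj /par /= upup.
  by exists 2; rewrite /= /par_adj /par /= upup.
pose G := par_graph par.
have cardG : #|G| = 2 * r by rewrite card_prod card_ord card_bool mulnC.
have match_r : r <= match_num G.
  rewrite -[leqLHS]card_ord (@pairs_match_num G 'I_r id) // => i.
  by apply/andP; split; [apply/eqP | rewrite eqxx orbT].
have lift_lt (i : 'I_q) : i < r by apply: leq_trans (ltn_ord i) _; lia.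
pose lft (i : 'I_q) := Ordinal (lift_lt i).
have lft_inj : injective lft by move=> i j [] /val_inj.
have le_q_ind : q <= ind_match G.
  pose h (u : ('I_q * bool)%type) : G := (lft u.1, u.2).
  rewrite -[leqLHS]card_ord (@pairs_ind_match G 'I_q h) //.
  - by move=> [i b] [j c] [] eij ->; rewrite (val_inj eij).
  - by move=> i; apply/andP; split; [apply/eqP | rewrite eqxx orbT].
  (* Values of [up] are at least [q], so no parent link joins two different pairs of index below
     [q]. *)
  have noup (i j : 'I_q) b : (up (lft i), false) <> (lft j, b) :> T.
    by case=> eij _; have := up_ge (lft i); rewrite eij /= leqNgt ltn_ord.
  move=> i j b c /andP[_]; rewrite /par /=.
  case: b c => [] [] //= /orP[]/eqP E //; by [case: E => /val_inj | case: (noup _ _ _ E)].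
have min_le_q : min_match G <= q.
  (* The partner of [(i, false)]: across the middle edge if [i] starts a path, along the single edge
     otherwise. *)
  pose far (i : 'I_q) : T := if q + i < r then (up (lft i), false) else (lft i, true).
  pose h (u : ('I_q * bool)%type) : G := if u.2 then far u.1 else (lft u.1, false).
  have upl (i : 'I_q) : q + i < r -> up (lft i) = q + i :> nat.
    by move=> ?; rewrite upE //=.
  have nfar i j : far i <> (lft j, false).
    rewrite /far; case: ifP => // _ [] E; have := up_ge (lft i).
    by rewrite E /= leqNgt ltn_ord.
  have far_inj : injective far.
    move=> i j; rewrite /far; case: ifP => qi; case: ifP => qj // [].
      by move/(congr1 val); rewrite /= !upl // => /addnI/val_inj.
    by move/val_inj.
  rewrite -[leqRHS]card_ord (@pairs_min_match G 'I_q h) //.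
  - move=> [i []] [j []]; rewrite /h /=.
    + by move/far_inj->.
    + by move/nfar.
    + by move/esym/nfar.
    + by case=> /val_inj->.
  - move=> i; apply/andP; split; first by apply/eqP => /esym/nfar.
    by rewrite /h /far /par /=; case: ifP => _; rewrite eqxx ?orbT.
  (* The vertices (i, false) are all covered, and the others are independent. *)
  have inner (i : 'I_r) : exists u, (i, false) = h u.
    have [iq|qi] := ltnP i q.
      by exists (Ordinal iq, false); congr pair; apply: val_inj.
    have iq : i - q < q by have := ltn_ord i; lia.
    exists (Ordinal iq, true); rewrite /h /far /= subnKC // ltn_ord.
    by congr pair; apply: val_inj; rewrite /= upl /= subnKC.
  move=> [i []] [j []]; rewrite /= /par_adj /par /=; last by left.
  - by case/andP=> _ /orP[]/eqP.
  - by right.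
  - by left.
have := ind_match_leq_min G; have := match_num_card G; rewrite cardG => *.
exists G; last first.
  by apply: leq_trans (par_graph_edges par_root) _; rewrite (cardG : #|T| = _); lia.
split; [exact: par_graph_connected par_iter|lia..].
Qed.

(** * The clique with a pendant edge at each vertex *)

Section PendantClique.
Variable n : nat.

(** The clique consists of the [(i, false)], and [(i, true)] hangs at [(i, false)]. *)
Definition pendant_adj (x y : 'I_n * bool) :=
  (x != y) && ((x.1 == y.1) || ~~ x.2 && ~~ y.2).

Lemma pendant_adj_sym : symmetric pendant_adj.
Proof. by move=> x y; rewrite /pendant_adj eq_sym (eq_sym x.1) (andbC (~~ x.2)). Qed.

Lemma pendant_adj_irrefl : irreflexive pendant_adj.
Proof. by move=> x; rewrite /pendant_adj eqxx. Qed.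

Definition pendant_clique := SGraph pendant_adj_sym pendant_adj_irrefl.

Local Notation G := pendant_clique.

Lemma pendant_adj_pendant i : @adj G (i, false) (i, true).
Proof. by apply/andP; split; [apply/eqP | rewrite eqxx]. Qed.

Lemma pendant_adj_clique i j : i != j -> @adj G (i, false) (j, false).
Proof. by move=> ij; rewrite /= /pendant_adj xpair_eqE (negPf ij). Qed.

Lemma card_pendant_clique : #|G| = 2 * n.
Proof. by rewrite card_prod card_ord card_bool mulnC. Qed.

Lemma pendant_clique_edges : #|edges G| <= 'C(n + 1, 2).
Proof.
pose draws k := [set A : {set 'I_n} | #|A| == k].
have -> : 'C(n + 1, 2) = #|draws 1 :|: draws 2|.
  rewrite cardsU (_ : _ :&: _ = set0) ?cards0 ?subn0 ?card_draws ?card_ord.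
    by rewrite addn1 binS addnC.
  by apply/setP=> A; rewrite !inE; case: eqP => [->|].
(* A singleton gives a pendant edge, with both booleans allowed; a pair gives a clique edge, with
   only [false] allowed. *)
pose edge_of (A : {set 'I_n}) : {set G} := 
  [set x | (x.1 \in A) && (x.2 ==> (#|A| == 1))].
apply: leq_trans (leq_imset_card edge_of (draws 1 :|: draws 2)).
apply/subset_leq_card/subsetP => e eE.
have [x [y [/andP[xy /orP[/eqP xy1|/andP[x2 y2]]] De]]] := @edgesP G _ eE.
  apply/imsetP; exists [set x.1]; first by rewrite !inE cards1.
  rewrite {}De; apply/setP => z; rewrite !inE cards1 implybT andbT.
  move: x y z xy xy1 => [i b] [j c] [k d] /= + ij; rewrite -{}ij !xpair_eqE eqxx /=.
  by case: b c d => [] [] []; rewrite ?andbT ?andbF ?orbF.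
have xy1 : x.1 != y.1.
  apply: contra xy => /eqP xy1; apply/eqP.
  by case: x y x2 y2 xy1 {De} => [i []] [j []] //= _ _ ->.
apply/imsetP; exists [set x.1; y.1]; first by rewrite !inE cards2 xy1.
rewrite De; apply/setP => z; rewrite !inE cards2 xy1 implybF.
case: x y z x2 y2 {De xy xy1} => [i []] [j []] [k d] // _ _.
by rewrite !xpair_eqE -andb_orl eqbF_neg.
Qed.

Lemma pendant_clique_connected : 0 < n -> connected_graph G.
Proof.
move=> n_gt0; pose r : G := (Ordinal n_gt0, false).
have inner i : connect (@adj G) (i, false) r.
  have [->|ij] := eqVneq i r.1; first exact: connect0.
  exact/connect1/pendant_adj_clique.
have tor x : connect (@adj G) x r.
  case: x => i [] //; apply: connect_trans (inner i); apply: connect1.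
  by rewrite adj_sym pendant_adj_pendant.
split; first by apply/card_gt0P; exists r.
move=> x y; apply: connect_trans (tor x) _.
by rewrite (sym_connect_sym (@adj_sym G)) tor.
Qed.

Lemma pendant_edge_inner (e : {set G}) : e \in edges G -> exists i, (i, false) \in e.
Proof.
move=> eE; have [[i b] [[j c] [/andP[/= ij aij] De]]] := @edgesP G _ eE.
move: ij aij De; case: b => [|_ _ ->]; last by exists i; rewrite set21.
case: c => [|_ _ ->]; last by exists j; rewrite set22.
by move=> ij /orP[/eqP eij|//]; rewrite eij eqxx in ij.
Qed.

Lemma pendant_edge_outer (e : {set G}) i :
  e \in edges G -> (i, true) \in e -> (i, false) \in e.
Proof.
move=> eE ie; have [j je] := pendant_edge_inner eE.
suff -> : i = j by [].
have [x [y [/andP[_ xy] De]]] := @edgesP G _ eE; move: ie je; rewrite De !inE.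
case/orP=> /eqP Dx /orP[] /eqP Dy; move: xy; rewrite -?Dx -?Dy /= ?andbF ?orbF.
- by move: Dy; rewrite -Dx.
- by move/eqP.
- by move/eqP.
- by move: Dy; rewrite -Dx.
Qed.

(** Every edge has an end in the clique, so any two disjoint edges are joined by a clique edge. *)
Lemma pendant_clique_ind : ind_match G <= 1.
Proof.
have [N indN <-] := ind_match_witness G; rewrite leqNgt.
have /andP[mN _] := indN; have /andP[/subsetP sN _] := mN.
apply/card_gt1P => -[e [f [eN fN ef]]].
have [i ie] := pendant_edge_inner (sN e eN).
have [j jf] := pendant_edge_inner (sN f fN).
case/eqP: ef; have [eij|ij] := eqVneq i j.
  by apply: (matching_meet mN eN fN); apply/meetP; exists (i, false); rewrite // eij.
apply: (induced_meet indN eN fN (edge_set2 (pendant_adj_clique ij))); apply/meetP.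
  by exists (i, false); rewrite // set21.
by exists (j, false); rewrite // set22.
Qed.

Lemma pendant_clique_match : match_num G = n.
Proof.
apply/eqP; rewrite eqn_leq; have := match_num_card G.
rewrite card_pendant_clique leq_pmul2l // => -> /=.
rewrite -[leqLHS]card_ord (@pairs_match_num G 'I_n id) // => i.
exact: pendant_adj_pendant.
Qed.

(* A maximal matching covers every vertex of the clique, since it covers an end
of each pendant edge. *)
Lemma pendant_clique_min_ge : n <= 2 * min_match G.
Proof.
have [M maxM <-] := min_match_witness G; have mM := maxsetp maxM.
have /andP[/subsetP sM _] := mM.
rewrite -(card_cover_matching mM) -[leqLHS]card_ord.
have inj : injective (fun i : 'I_n => (i, false) : G) by move=> i j [].
rewrite -(card_imset _ inj); apply/subset_leq_card/subsetP => _ /imsetP[i _ ->].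
have [f fM] := maximal_meet maxM (edge_set2 (pendant_adj_pendant i)).
case/meetP=> x xf; rewrite !inE => /orP[]/eqP Dx; rewrite {}Dx in xf.
  by apply/bigcupP; exists f.
by apply/bigcupP; exists f => //; apply: pendant_edge_outer => //; apply: sM.
Qed.

(** Matching the clique vertices [2 i] and [2 i + 1], and for odd [n] the last one with its pendant
    vertex, covers the clique, which is a vertex cover. *)
Lemma pendant_clique_min_le : min_match G <= uphalf n.
Proof.
have lt2 (i : 'I_(uphalf n)) : i.*2 < n by have := ltn_ord i; lia.
pose evn i : 'I_n := Ordinal (lt2 i).
(* [insub] fails exactly when [2 i + 1 = n], at the unpaired last vertex. *)
pose far (i : 'I_(uphalf n)) : G :=
  if insub i.*2.+1 is Some k then (k, false) else (evn i, true).
pose h (u : 'I_(uphalf n) * bool) : G := if u.2 then far u.1 else (evn u.1, false).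
have evn_inj : injective evn by move=> i j [] /double_inj/val_inj.
have nfar i j : far i <> (evn j, false).
  by rewrite /far; case: insubP => [k _ Dk|_] // [] /(congr1 val); rewrite /= Dk; lia.
have far_inj : injective far.
  move=> i j; rewrite /far; case: insubP => [k _ Dk|_]; case: insubP => [l _ Dl|_] //.
    by case=> Dkl; apply: val_inj; move: Dk; rewrite Dkl Dl /=; lia.
  by case=> /double_inj/val_inj.
have inner (i : 'I_n) : exists u, (i, false) = h u.
  have lt_half : i./2 < uphalf n by have := ltn_ord i; lia.
  exists (Ordinal lt_half, odd i); rewrite /h /far /=; case: ifP => oi.
    have Di : i./2.*2.+1 = i by lia.
    by rewrite Di; case: insubP => [k _ /val_inj->|]; rewrite ?ltn_ord.
  by congr pair; apply: val_inj => /=; lia.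
rewrite -[leqRHS]card_ord (@pairs_min_match G 'I_(uphalf n) h) //.
- move=> [i []] [j []]; rewrite /h /=.
  + by move/far_inj->.
  + by move/nfar.
  + by move/esym/nfar.
  + by case=> /double_inj/val_inj->.
- move=> i; rewrite /h /far /=; case: insubP => [k _ Dk|_].
    by apply: pendant_adj_clique; rewrite -val_eqE /= Dk; lia.
  exact: pendant_adj_pendant.
move=> [i []] [j []] /=; [|by right|by left|by left].
by case/andP=> ij; rewrite orbF => /eqP /= eij; rewrite eij eqxx in ij.
Qed.

End PendantClique.

Lemma pendant_clique_realizes n :
  0 < n -> realizes 1 (uphalf n) n (pendant_clique n).
Proof.
move=> n_gt0; split.
- exact: pendant_clique_connected.
- apply/eqP; rewrite eqn_leq pendant_clique_ind.
  (* A single pendant edge is an induced matching of size one. *)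
  pose h (u : unit * bool) : pendant_clique n := (Ordinal n_gt0, u.2).
  rewrite -[leqLHS]card_unit (@pairs_ind_match _ unit h) //.
  + by move=> [[] b] [[] c] [->].
  + by move=> [] [].
- by apply/eqP; have := pendant_clique_min_ge n; have := pendant_clique_min_le n; lia.
- exact: pendant_clique_match.
Qed.

(** * The minimum numbers of edges *)

Lemma min_edges_eqI p q r m :
  (exists2 G : sgraph, realizes p q r G & #|edges G| <= m) ->
  (forall G : sgraph, realizes p q r G -> m <= #|edges G|) ->
  min_edges_eq p q r m.
Proof.
case=> G rG leG geG; split=> //; exists G => //.
(* The lower bound applies to [G] itself, so an upper bound on its edges suffices. *)
by apply/eqP; rewrite eqn_leq leG geG.
Qed.

Lemma min_edges_eq_clique n :
  0 < n -> min_edges_eq 1 (uphalf n) n 'C(n + 1, 2).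
Proof.
move=> n_gt0; apply: min_edges_eqI.
  exists (pendant_clique n); first exact: pendant_clique_realizes.
  exact: pendant_clique_edges.
by move=> G [_ ind1 _ <-]; apply: clique_edges; rewrite ind1.
Qed.

Theorem theorem3p1 (p q r : nat)
  (hp : 1 <= p) (hpq : p <= q) (hqr : q <= r) (hr : r <= 2 * q) :
  [/\ forall q' : nat, 1 <= q' ->
        min_edges_eq 1 q' (2 * q') 'C(2 * q' + 1, 2) /\
        min_edges_eq 1 q' (2 * q' - 1) 'C(2 * q', 2),
      2 <= p -> p = q -> q < r -> r <= 2 * q ->
        min_edges_eq q q r (2 * r - 1)
    & 2 <= p -> p = q -> q = r ->
        min_edges_eq r r r (2 * r)].
Proof.
split=> [q' q'_gt0|_ _ ltqr ler2q|p2 pq qr].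
(* Both claims of the first case are instances of the pendant clique, with [n = 2 * q'] and
   [n = 2 * q' - 1]. *)
- have q'E : uphalf (2 * q') = q' by lia.
  have q'oddE : uphalf (2 * q' - 1) = q' by lia.
  split; first by rewrite -{1}q'E; apply: min_edges_eq_clique; lia.
  (* Only the binomial coefficient is rewritten, into the form ['C(n + 1, 2)]. *)
  have {2}-> : 2 * q' = 2 * q' - 1 + 1 by lia.
  by rewrite -{1}q'oddE; apply: min_edges_eq_clique; lia.
- apply: min_edges_eqI; first exact: tree_realizes.
  by move=> G [conn _ _ <-]; apply: match_num_edges.
apply: min_edges_eqI; first by apply: spider_realizes; lia.
move=> G [conn indr _ _]; rewrite -indr; apply: ind_match_edges => //.
by rewrite indr -qr -pq.
Qed.
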